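(* Let $\mathcal{A}_d:Q\times Q\to G$ be a discrete connection $1$-form. Then: 1. The discrete horizontal lift $(\cdot,\cdot)^h:S\times S\to(Q\times Q)/G$ is given by $$(x_0,x_1)^h=\big[(\pi,\pi)^{-1}(x_0,x_1)\cap\mathcal{A}_d^{-1}(e)\big]_G ;$$ that is, for each $(x_0,x_1)\in S\times S$ the set $(\pi,\pi)^{-1}(x_0,x_1)\cap\mathcal{A}_d^{-1}(e)$ is a single orbit of the diagonal $G$-action on $Q\times Q$, and for $q_0\in\pi^{-1}(x_0)$ the lift $(x_0,x_1)^h_{q_0}$ is the element of this orbit with first component $q_0$. 2. For all $(q_0,q_1)\in Q\times Q$, $$i_{q_0}(\mathcal{A}_d(q_0,q_1))\cdot(\pi q_0,\pi q_1)^h_{q_0}=(q_0,q_1),$$ so that $\mathcal{A}_d$ and the discrete horizontal lift induce a decomposition of $(q_0,q_1)$ into a vertical element $i_{q_0}(\mathcal{A}_d(q_0,q_1))$ and a horizontal element $(\pi q_0,\pi q_1)^h_{q_0}$. 3. In a local trivialization in which $q_0=(x_0,g_0)$, $$(x_0,x_1)^h_{q_0}=\big((x_0,g_0),(x_1,g_0\,(A(x_0,x_1))^{-1})\big),\qquad\text{where } A(x_0,x_1)=\mathcal{A}_d((x_0,e),(x_1,e)).$$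
   Context: $Q$ is a smooth manifold with a free smooth left action $(g,q)\mapsto gq$ of a Lie group $G$ such that the projection $\pi:Q\to S=Q/G$ is a submersion; $e$ is the identity of $G$. $G$ acts on $Q\times Q$ diagonally, $[\,\cdot\,]_G$ denotes the class in $(Q\times Q)/G$, and $(\pi,\pi)(q_0,q_1)=(\pi q_0,\pi q_1)$. The discrete generator is $i_q(g)=(q,gq)$; elements of this form are called vertical. The composition of a vertical element with an arbitrary element is $i_{q_0}(g)\cdot(q_0,q_1)=(q_0,gq_1)$. A discrete connection $1$-form is a map $\mathcal{A}_d:Q\times Q\to G$ such that $\mathcal{A}_d(gq_0,hq_1)=h\,\mathcal{A}_d(q_0,q_1)\,g^{-1}$ for all $g,h\in G$, $q_0,q_1\in Q$ (in particular $\mathcal{A}_d(gq_0,gq_1)=g\mathcal{A}_d(q_0,q_1)g^{-1}$) and $\mathcal{A}_d(q,gq)=g$ for all $q\in Q,\ g\in G$. Its horizontal space at $q$ is $\operatorname{Hor}_q=\{(q,q')\in Q\times Q\mid\mathcal{A}_d(q,q')=e\}$. For $(x_0,x_1)\in S\times S$ and $q\in\pi^{-1}(x_0)$, the discrete horizontal lift $(x_0,x_1)^h_q$ is the unique element of $\operatorname{Hor}_q$ with $(\pi,\pi)\big((x_0,x_1)^h_q\big)=(x_0,x_1)$, and $(x_0,x_1)^h\in(Q\times Q)/G$ is its class (independent of $q$). A local trivialization identifies points of $Q$ lying over an open set of $S$ containing the base points in question with pairs $(x,g)$, $x\in S$, $g\in G$, so that $\pi(x,g)=x$ and $k(x,g)=(x,kg)$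 for $k\in G$. *)

(* Defs.v *)
From HB Require Import structures.
From mathcomp Require Import all_boot all_order all_algebra generic_quotient.
From mathcomp Require Import all_classical all_reals all_analysis.

Set Implicit Arguments.
Unset Strict Implicit.
Unset Printing Implicit Defensive.

Import Order.TTheory GRing.Theory Num.Theory.
Import numFieldNormedType.Exports.

Local Open Scope classical_set_scope.
Local Open Scope ring_scope.
Local Open Scope quotient_scope.

Fixpoint Ck_on (R : realType) (V W : normedModType R) (k : nat) (D : set V)
    (f : V -> W) : Prop :=
  (forall u, D u -> {for u, continuous f}) /\
  (if k is k'.+1 then
     forall v, (forall u, D u -> derivable f u v) /\ Ck_on k' D ('D_v f)
   else True).

(* C^oo on D; meaningful for D open only *)
Definition Cinfty_on (R : realType) (V W : normedModType R) (D : set V)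
  (f : V -> W) : Prop := forall k, Ck_on k D f.

(* Only the restrictions of [chart_map] to [chart_dom] and of [chart_inv] to
   [chart_map @` chart_dom] matter. *)
Record chart (R : realType) (n : nat) (M : topologicalType) := Chart {
  chart_dom : set M;
  chart_map : M -> 'rV[R]_n;
  chart_inv : 'rV[R]_n -> M
}.

Record is_chart (R : realType) n (M : topologicalType) (c : chart R n M)
    : Prop := IsChart {
  chart_open_dom : open (chart_dom c);
  chart_open_img : open (chart_map c @` chart_dom c);
  chart_mapK : forall x, chart_dom c x -> chart_inv c (chart_map c x) = x;
  chart_map_cont :
    forall x, chart_dom c x -> {for x, continuous (chart_map c)};
  chart_inv_cont : forall u,
    (chart_map c @` chart_dom c) u -> {for u, continuous (chart_inv c)}
}.

Record smooth_manifold (R : realType) n (M : topologicalType)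
    (A : set (chart R n M)) : Prop := SmoothManifold {
  manifold_hausdorff : hausdorff_space M;
  manifold_second_countable : @second_countable M;
  manifold_chart : forall c, A c -> is_chart c;
  manifold_cover : forall x, exists2 c, A c & chart_dom c x;
  manifold_transition : forall c d, A c -> A d ->
    Cinfty_on (chart_map c @` (chart_dom c `&` chart_dom d))
              (chart_map d \o chart_inv c)
}.

(* meaningful for U open only *)
Definition smooth_on (R : realType) m n (M N : topologicalType)
    (A : set (chart R m M)) (B : set (chart R n N)) (U : set M) (f : M -> N)
    : Prop :=
  (forall x, U x -> {for x, continuous f}) /\
  (forall c d, A c -> B d ->
     Cinfty_on (chart_map c @` (chart_dom c `&` U `&` f @^-1` chart_dom d))
               (chart_map d \o f \o chart_inv c)).

Definition submersion (R : realType) m n (M N : topologicalType)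
    (A : set (chart R m M)) (B : set (chart R n N)) (f : M -> N) : Prop :=
  smooth_on A B setT f /\
  (forall c d x, A c -> B d -> chart_dom c x -> chart_dom d (f x) ->
     forall w, exists v,
       'd (chart_map d \o f \o chart_inv c) (chart_map c x) v = w).

Definition prod_chart (R : realType) m n (M N : topologicalType)
    (c : chart R m M) (d : chart R n N) : chart R (m + n)%N (M * N)%type :=
  Chart (chart_dom c `*` chart_dom d)
        (fun p => row_mx (chart_map c p.1) (chart_map d p.2))
        (fun u => (chart_inv c (lsubmx u), chart_inv d (rsubmx u))).

Definition prod_atlas (R : realType) m n (M N : topologicalType)
    (A : set (chart R m M)) (B : set (chart R n N))
    : set (chart R (m + n)%N (M * N)%type) :=
  [set prod_chart c d | c in A & d in B].

(* a type carrying both a group structure and a topology; that the two are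
   compatible is part of [lie_group] *)
#[short(type="groupTopologicalType")]
HB.structure Definition GroupTopological := {G of Group G & Topological G}.

Record lie_group (R : realType) n (G : groupTopologicalType)
    (A : set (chart R n G)) : Prop := LieGroup {
  lie_manifold : smooth_manifold A;
  lie_mul : smooth_on (prod_atlas A A) A setT (fun p : G * G => (p.1 * p.2)%g);
  lie_inv : smooth_on A A setT (fun g : G => g^-1%g)
}.

Record left_action (G : groupType) (X : Type) := LeftAction {
  act :> G -> X -> X;
  act1 : forall x, act 1%g x = x;
  actM : forall g h x, act (g * h)%g x = act g (act h x)
}.

Definition free_action (G : groupType) (X : Type) (a : left_action G X) : Prop :=
  forall g x, a g x = x -> g = 1%g.

Definition action_orbit (G : groupType) (X : Type) (a : left_action G X) (x : X)
  : set X := [set a g x | g in setT].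

Section OrbitSpace.
Variables (G : groupType) (X : choiceType) (a : left_action G X).

Definition orbit_rel : rel X := fun x y => `[< action_orbit a x y >].

Lemma orbit_rel_equiv : equiv_class_of orbit_rel.
Proof.
split=> [x|x y|y x z].
- by apply/asboolP; exists 1%g => //; rewrite act1.
- by apply/asboolP/asboolP => -[g _ <-]; exists g^-1%g => //;
    rewrite -actM mulVg act1.
- move=> /asboolP[g _ <-] /asboolP[h _ <-]; apply/asboolP.
  by exists (h * g)%g => //; rewrite actM.
Qed.

Canonical orbit_equiv_rel := EquivRelPack orbit_rel_equiv.

Definition orbit_quot := {eq_quot orbit_equiv_rel}.

HB.instance Definition _ := EqQuotient.on orbit_quot.
HB.instance Definition _ := Choice.on orbit_quot.

Definition orbit_class (x : X) : orbit_quot := \pi_orbit_quot x.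

End OrbitSpace.

Section DiscreteConnection.
Variables (G : groupType) (Q : topologicalType) (a : left_action G Q).

(* Q/G with the quotient topology *)
Definition base_space := quotient_topology (orbit_quot a).

HB.instance Definition _ := Topological.on base_space.
HB.instance Definition _ := Quotient.on base_space.

Definition base_proj (q : Q) : base_space := \pi_base_space q.

Definition base_proj2 (p : Q * Q) : base_space * base_space :=
  (base_proj p.1, base_proj p.2).

Definition diag_fun (g : G) (p : Q * Q) : Q * Q := (a g p.1, a g p.2).

Lemma diag_fun1 p : diag_fun 1%g p = p.
Proof. by case: p => q0 q1; rewrite /diag_fun !act1. Qed.

Lemma diag_funM g h p : diag_fun (g * h)%g p = diag_fun g (diag_fun h p).
Proof. by rewrite /diag_fun !actM. Qed.

Definition diag_action : left_action G (Q * Q)%type :=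
  LeftAction diag_fun1 diag_funM.

Definition discrete_generator (q : Q) (g : G) : Q * Q := (q, a g q).

Definition vertical (p : Q * Q) : Prop :=
  exists q g, p = discrete_generator q g.

(* The product v . p of a vertical v with base point p.1: it is
   (p.1, g p.2), where g is the group element (unique for a free action) such
   that v = i_{p.1}(g).  Junk value when there is no such g. *)
Definition vcomp (v p : Q * Q) : Q * Q :=
  (p.1, a (xget 1%g [set g | v = discrete_generator p.1 g]) p.2).

Record discrete_connection (Ad : Q * Q -> G) : Prop := DiscreteConnection {
  dconn_equivariant : forall g h q0 q1,
    Ad (a g q0, a h q1) = (h * Ad (q0, q1) * g^-1)%g;
  dconn_vertical : forall q g, Ad (discrete_generator q g) = g
}.

Definition Hor (Ad : Q * Q -> G) (q : Q) : set (Q * Q) :=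
  [set p | p.1 = q /\ Ad p = 1%g].

(* (x0, x1)^h_q, for q over x0; the default (q, q) of [xget] is junk, used
   only when there is no element as required *)
Definition hlift (Ad : Q * Q -> G) (x : base_space * base_space) (q : Q)
  : Q * Q := xget (q, q) (Hor Ad q `&` base_proj2 @^-1` [set x]).

(* (x0, x1)^h, computed at an arbitrary point over x0 *)
Definition hlift_class (Ad : Q * Q -> G) (x : base_space * base_space)
  : orbit_quot diag_action := orbit_class diag_action (hlift Ad x (repr x.1)).

End DiscreteConnection.

(* A local trivialization over U, given by [triv] on the part of Q over U and
   by its inverse [untriv] on U x G; values elsewhere are irrelevant. *)
Record local_trivialization (R : realType) (nG nQ nS : nat)
    (G : groupTopologicalType) (Q : topologicalType) (a : left_action G Q)
    (AG : set (chart R nG G)) (AQ : set (chart R nQ Q))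
    (AS : set (chart R nS (base_space a))) (U : set (base_space a))
    (triv : Q -> base_space a * G) (untriv : base_space a * G -> Q)
    : Prop := LocalTrivialization {
  triv_open : open U;
  trivK : forall q, U (base_proj a q) -> untriv (triv q) = q;
  untrivK : forall x g, U x -> triv (untriv (x, g)) = (x, g);
  triv_proj : forall q, U (base_proj a q) -> (triv q).1 = base_proj a q;
  untriv_proj : forall x g, U x -> base_proj a (untriv (x, g)) = x;
  untriv_act : forall k x g, U x -> a k (untriv (x, g)) = untriv (x, (k * g)%g);
  triv_smooth : smooth_on AQ (prod_atlas AS AG) (base_proj a @^-1` U) triv;
  untriv_smooth : smooth_on (prod_atlas AS AG) AQ (U `*` setT) untriv
}.

(* Main.v *)
(* Equivariance gives A_d(q0, g q1) = g A_d(q0, q1), so along the fibre of q1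
   the equation A_d(q0, q) = e has exactly one solution, namely
   q = A_d(q0, q1)^-1 q1.  This explicit formula for the horizontal lift
   yields the three parts. *)
Require Import Defs.
From HB Require Import structures.
From mathcomp Require Import all_boot all_order all_algebra generic_quotient.
From mathcomp Require Import all_classical all_reals all_analysis.

Local Open Scope classical_set_scope.

Section GroupAction.
Set Implicit Arguments.
Variables (G : groupType).

Lemma free_actI (X : Type) (a : left_action G X) x : free_action a -> injective (a^~ x).
Proof.
move=> a_free g h /= agh; have /a_free : a (h^-1 * g)%g x = x.
  by rewrite actM agh -actM mulVg act1.
by move/(congr1 (fun k => h * k)%g); rewrite mulVKg mulg1.
Qed.

(** Lets the class of the lift be read off once the set in the first claim is known to be an
    orbit. *)
Lemma orbit_class_image (X : choiceType) (a : left_action G X) x :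
  orbit_class a @` action_orbit a x = [set orbit_class a x].
Proof.
apply/seteqP; split=> [_ [_ [g _ <-] <-]|_ ->].
  by apply/esym/eqmodP/asboolP; exists g.
by exists x => //; exists 1%g; rewrite ?act1.
Qed.

End GroupAction.

Section HorizontalLift.
Set Implicit Arguments.
Variables (G : groupType) (Q : topologicalType) (a : left_action G Q).

Lemma base_proj_eqP q q' :
  base_proj a q = base_proj a q' <-> exists g, a g q = q'.
Proof.
split=> [/eqmodP/asboolP[g _ <-]|[g <-]]; first by exists g.
by apply/eqmodP/asboolP; exists g.
Qed.

Lemma base_proj_act g q : base_proj a (a g q) = base_proj a q.
Proof. by apply/esym/base_proj_eqP; exists g. Qed.

Lemma base_proj_repr (x : base_space a) : base_proj a (repr x) = x.
Proof. exact: reprK. Qed.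

(** Freeness makes the group element that [xget] picks in [vcomp] unique, so it must be [g]; the
    default [1%g] never occurs. *)
Lemma vcomp_generator q g q' : free_action a ->
  vcomp a (discrete_generator a q g) (q, q') = (q, a g q').
Proof.
move=> a_free; rewrite /vcomp /=; case: xgetP => [h _|/(_ g)]; last by case.
by move=> -[/(free_actI _ a_free) <-].
Qed.

Variables (Ad : Q * Q -> G) (conn : discrete_connection a Ad).

Lemma dconn_actl g q0 q1 : Ad (a g q0, q1) = (Ad (q0, q1) * g^-1)%g.
Proof. by rewrite -{1}[q1](act1 a) (dconn_equivariant conn) mul1g. Qed.

Lemma dconn_actr h q0 q1 : Ad (q0, a h q1) = (h * Ad (q0, q1))%g.
Proof. by rewrite -{1}[q0](act1 a) (dconn_equivariant conn) invg1 mulg1. Qed.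

Lemma Hor_fiber q0 q1 :
  Hor Ad q0 `&` base_proj2 a @^-1` [set (base_proj a q0, base_proj a q1)]
  = [set (q0, a (Ad (q0, q1))^-1%g q1)].
Proof.
apply/seteqP; split=> [[r0 r1]|_ ->]; last first.
  by split; rewrite /Hor /base_proj2 /= ?base_proj_act // dconn_actr mulVg.
move=> [[/= -> Ad1] [/esym/base_proj_eqP[g gq1]]].
move: Ad1; rewrite -gq1 dconn_actr.
move=> /(congr1 (fun k => k * (Ad (q0, q1))^-1)%g).
by rewrite mulgK mul1g => ->.
Qed.

(** The set searched by [xget] is a singleton by [Hor_fiber], so the junk default of [hlift] is
    never returned. *)
Lemma hliftE q0 q1 : hlift Ad (base_proj a q0, base_proj a q1) q0
  = (q0, a (Ad (q0, q1))^-1%g q1).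
Proof. by rewrite /hlift Hor_fiber; apply: xget_unique. Qed.

(** Pairs over the same base points have the form [(a g q0, a h q1)]. There [Ad] equals [h * g^-1],
    which is trivial exactly when [g = h]. *)
Lemma diag_orbit_horizontal q0 q1 : Ad (q0, q1) = 1%g ->
  base_proj2 a @^-1` [set (base_proj a q0, base_proj a q1)]
    `&` Ad @^-1` [set 1%g] = action_orbit (diag_action a) (q0, q1).
Proof.
move=> Ad1; apply/seteqP; split=> [[r0 r1]|_ [g _ <-]]; last first.
  split; rewrite /= ?(dconn_equivariant conn) ?Ad1 ?mulg1 ?mulgV //.
  by rewrite /base_proj2 /= !base_proj_act.
move=> [/= [/esym/base_proj_eqP[g <-] /esym/base_proj_eqP[h <-]]].
rewrite (dconn_equivariant conn) Ad1 mulg1 => /(congr1 (fun k => k * g)%g).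
by rewrite mulgVK mul1g => ->; exists g.
Qed.

End HorizontalLift.

Theorem proposition4p7 (R : realType) (nG nQ nS : nat)
    (G : groupTopologicalType) (AG : set (chart R nG G)) (lieG : lie_group AG)
    (Q : topologicalType) (AQ : set (chart R nQ Q)) (manQ : smooth_manifold AQ)
    (a : left_action G Q)
    (a_smooth : smooth_on (prod_atlas AG AQ) AQ setT
                          (fun p : G * Q => a p.1 p.2))
    (a_free : free_action a)
    (AS : set (chart R nS (base_space a))) (manS : smooth_manifold AS)
    (base_proj_subm : submersion AQ AS (base_proj a))
    (Ad : Q * Q -> G) (conn : discrete_connection a Ad) :
  [/\ (forall x0 x1 : base_space a,
         let F := base_proj2 a @^-1` [set (x0, x1)] `&` Ad @^-1` [set 1%g] in
         [/\ exists p, F = action_orbit (diag_action a) p,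
             orbit_class (diag_action a) @` F = [set hlift_class Ad (x0, x1)]
           & forall q0, base_proj a q0 = x0 ->
               F `&` [set p | p.1 = q0] = [set hlift Ad (x0, x1) q0]]),
      (forall q0 q1 : Q,
         let v := discrete_generator a q0 (Ad (q0, q1)) in
         let h := hlift Ad (base_proj a q0, base_proj a q1) q0 in
         [/\ vcomp a v h = (q0, q1), vertical a v & Hor Ad q0 h])
    & (forall (U : set (base_space a)) triv untriv,
         local_trivialization AG AQ AS U triv untriv ->
         forall (x0 x1 : base_space a) (g0 : G) (q0 : Q),
           U x0 -> U x1 -> q0 = untriv (x0, g0) ->
           let A := Ad (untriv (x0, 1%g), untriv (x1, 1%g)) in
           hlift Ad (x0, x1) q0
           = (untriv (x0, g0), untriv (x1, (g0 * A^-1)%g)))].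
Proof.
split=> [x0 x1 F|q0 q1 v h|U triv untriv tr x0 x1 g0 q0 Ux0 Ux1 -> A].
(* The point [p] generating the orbit is also required to be the lift at [repr x0], because
   [hlift_class] is computed there; one witness then settles both the orbit and its class. *)
- have [p [Fp hp]] : exists p, F = action_orbit (diag_action a) p
      /\ hlift Ad (x0, x1) (repr x0) = p.
    set q0 := repr x0; set q1 := repr x1.
    exists (q0, a (Ad (q0, q1))^-1%g q1); split.
      rewrite -(diag_orbit_horizontal conn); last first.
        by rewrite (dconn_actr conn) mulVg.
      by rewrite /F base_proj_act !base_proj_repr.
    by rewrite -(hliftE conn) !base_proj_repr.
  split; first by exists p.
    by rewrite Fp orbit_class_image /hlift_class hp.
  move=> q0 qx0; rewrite /F -qx0 -[x1]base_proj_repr (hliftE conn).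
  (* [Hor Ad q0] unfolds to the intersection of the condition on the first component with the
     preimage of [1%g], so only the order of three intersected sets has to change. *)
  by rewrite -(Hor_fiber conn) setIC [_ `&` Ad @^-1` _]setIC setIA.
- split; last 2 first.
  + by exists q0, (Ad (q0, q1)).
  + by rewrite /h (hliftE conn); split=> //=; rewrite (dconn_actr conn) mulVg.
  (* The lift moves [q1] by the inverse of [Ad (q0, q1)], and the vertical factor moves it back. *)
  by rewrite /h (hliftE conn) vcomp_generator // -actM mulgV act1.
(* Over [U], every point is a translate of the unit section through [untriv (x, 1%g)]. *)
- have act_untriv k x : U x -> untriv (x, k) = a k (untriv (x, 1%g)).
    by move=> Ux; rewrite (untriv_act tr) // mulg1.
  (* The explicit formula needs a point over each base point: the given one over [x0], the unit
     section over [x1]. *)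
  rewrite -{1}(untriv_proj tr g0 Ux0) -{1}(untriv_proj tr 1%g Ux1) (hliftE conn).
  (* Pulling [g0] out of the first argument turns [Ad] into [A * g0^-1], whose inverse is
     [g0 * A^-1]. *)
  rewrite [in Ad _](act_untriv g0) // (dconn_actl conn) -/A invgM invgK.
  by rewrite -act_untriv.
Qed.
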